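(* Let $\lambda$ be an infinite cardinal and $\{X_\alpha:\alpha<\lambda\}$ a family of non-trivial Tychonoff spaces such that $iw(X_\alpha)\leq\lambda$ for every $\alpha<\lambda$. If $X_\pi:=\prod_{\alpha<\lambda}X_\alpha$, then $$\mathsf{C}(C_p(X_\pi))=\{\kappa:\kappa\text{ is an infinite cardinal and }\mathrm{cf}(\kappa)>\lambda\}.$$ Hence, if $X$ is a non-trivial Tychonoff space with $iw(X)\leq\lambda$, then $\mathsf{C}(C_p(X^\lambda))=\{\kappa:\kappa\text{ is an infinite cardinal and }\mathrm{cf}(\kappa)>\lambda\}$.
   Context: A space is non-trivial if it has at least two points. The weight is $w(Y)=\min\{|\mathcal{B}|:\mathcal{B}\text{ a base for }Y\}+\omega$. A condensation is a continuous bijection; $iw(X)$ (the $i$-weight) is the least $w(Y)$ among Tychonoff spaces $Y$ onto which $X$ condenses. For a Tychonoff space $X$, $C_p(X)$ is the set of continuous functions $X\to\mathbb{R}$ with the topology of pointwise convergence (the subspace topology from $\mathbb{R}^X$). An infinite cardinal $\kappa$ is a caliber for a space $Z$ if for every set $I$ with $|I|=\kappa$ and every indexed family $\{U_\alpha:\alpha\in I\}$ of nonempty open subsets of $Z$ there is $J\subseteq I$ with $|J|=\kappa$ and $\bigcap_{\alpha\in J}U_\alpha\neq\emptyset$. $\mathsf{C}(Z)$ denotes the class of all infinite cardinals that are calibers for $Z$. *)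

(* Defs.v *)
From mathcomp Require Import all_boot all_order all_algebra.
From mathcomp Require Import all_classical all_reals all_analysis.
From mathcomp Require wochoice.
Import numFieldNormedType.Exports.

Set Implicit Arguments.
Unset Strict Implicit.
Unset Printing Implicit Defensive.

Local Open Scope classical_set_scope.
Local Open Scope card_scope.

(* A cardinal is represented by any type of that cardinality, and a class of
   cardinals by a predicate on types. Such a predicate has type [Type -> Prop]
   rather than [set Type] so that the cardinals are not confined to a universe
   strictly below the one of [set]. *)

Definition infinite_card (K : Type) : Prop := infinite_set [set: K].

Definition card_lt T U (A : set T) (B : set U) : Prop :=
  A #<= B /\ ~ (B #<= A).

Definition least_card (F : Type -> Prop) (K : Type) : Prop :=
  F K /\ forall M : Type, F M -> [set: K] #<= [set: M].

(* The order type of [R] is the initial ordinal of the cardinal [K]: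
   [[set y | ~~ R x y]] is the set of the strict predecessors of [x]. *)
Definition initial_well_order (K : Type) (R : rel K) : Prop :=
  wochoice.well_order R /\ forall x : K, card_lt [set y | ~~ R x y] [set: K].

Definition cofinal (K : Type) (R : rel K) (A : set K) : Prop :=
  forall x : K, exists2 y, A y & R x y.

Definition cofinality (K C : Type) : Prop :=
  exists2 R : rel K, initial_well_order R &
    least_card (fun M => exists2 A : set K, cofinal R A & [set: M] #= A) C.

Definition cofinality_gt (K L : Type) : Prop :=
  exists2 C : Type, cofinality K C & card_lt [set: L] [set: C].

Definition nontrivial_space (X : topologicalType) : Prop :=
  exists x y : X, x <> y.

(* [uniform_separatorP] shows that the library's separation condition is the
   existence of a continuous separating function into the unit interval. *)
Definition tychonoff_space (X : topologicalType) : Prop :=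
  completely_regular_space X /\ accessible_space X.

(* The sum type with [nat] is the term [+ omega]. *)
Definition weight (Y : topologicalType) (W : Type) : Prop :=
  exists2 M : Type,
    least_card (fun N => exists2 B : set (set Y), basis B & [set: N] #= B) M &
    [set: W] #= [set: M + nat].

Definition condensation (X Y : topologicalType) (f : X -> Y) : Prop :=
  continuous f /\ bijective f.

Definition iweight (X : topologicalType) : Type -> Prop :=
  least_card (fun W => exists Y : topologicalType,
    [/\ tychonoff_space Y, exists f : X -> Y, condensation f & weight Y W]).

Definition iweight_le (X : topologicalType) (L : Type) : Prop :=
  exists2 W : Type, iweight X W & [set: W] #<= [set: L].

Definition Cp (R : realType) (X : topologicalType) : topologicalType :=
  set_type [set f : {ptws X -> R} | continuous (f : X -> R)].

Definition caliber (Z : topologicalType) (K : Type) : Prop :=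
  forall I : Type, [set: I] #= [set: K] ->
  forall U : I -> set Z, (forall i, open (U i)) -> (forall i, U i !=set0) ->
  exists2 J : set I, J #= [set: K] & \bigcap_(i in J) U i !=set0.

Definition calibers (Z : topologicalType) (K : Type) : Prop :=
  infinite_card K /\ caliber Z K.

(* Main.v *)
Require Import Defs.
From mathcomp Require Import all_boot all_order all_algebra.
From mathcomp Require Import all_classical all_reals all_analysis.
From mathcomp Require Import lra.
From mathcomp Require wochoice.
Import numFieldNormedType.Exports.
Import Order.TTheory GRing.Theory Num.Theory.

(** Write [X] for the product.  Both inclusions compare the cofinality of [K]
    with [L].

    If [cf K > L], it suffices that [Cp R X] has a dense family indexed by a type
    of cardinality at most [L]: choose in each of [K] many nonempty open sets a
    member of the family; as [cf K > L], one member is chosen [K] many times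
    ([cofinality_pigeonhole], [caliber_of_dense_family]).  For the dense family,
    a condensation of a factor onto a Tychonoff space of weight at most [L]
    provides, from the pairs of sets of a base, [L] many continuous functions on
    that factor such that any two distinct points are sent to 1 and 0 by one of
    them ([iweight_separating01]).  Composed with the projections, they do the
    same on [X] ([prod_separating01]).  The sums of products of such functions
    with rational coefficients interpolate any finite data up to an arbitrarily
    small error ([rat_combination_dense]), and they are at most [L] many because
    [L * L] and the finite sequences over [L] have cardinality [L]
    ([card_setX_le], [card_seq_le]).

    If [cf K <= L], a point-finite family of [L] nonempty open sets of [Cp R X]
    shows that [K] is not a caliber ([cofinality_gt_of_caliber]).  Such a family
    exists because [X] contains a copy of the one-point compactification of the
    discrete space [L]: points [e a], indexed by [L], that differ from a base
    point [p] in the coordinate [a] only, and so converge to [p].  By continuity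
    at [p], a function with [f p < 0] satisfies [f (e a) > 0] for finitely many
    [a] only.

    The cardinal arithmetic behind this, namely the well-ordering of cardinals,
    the equality of [L * L] and [L], and the existence of initial orders and of
    cofinalities, is derived from Zorn's lemma and the well-ordering principle. *)

Set Implicit Arguments.
Unset Strict Implicit.
Unset Printing Implicit Defensive.

Local Open Scope classical_set_scope.
Local Open Scope card_scope.

(** * Comparison and squares of infinite cardinals *)

Lemma card_leTP (T U : Type) :
  [set: T] #<= [set: U] <-> exists f : T -> U, injective f.
Proof.
split=> [/card_leP[f]|[f injf]].
  exists (fun x => set_val (f (SigSub (mem_setT x)))) => x y /val_inj.
  by move/(@inj _ _ _ f _ _ (mem_setT _) (mem_setT _))/(congr1 set_val).
have /injPex[{injf}f] : exists f : T -> U, set_inj [set: T] f.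
  by exists f => x y _ _; exact: injf.
by apply: inj_card_le; exact: ('totalfun_[set: T] f).
Qed.

Lemma card_leT_set (T U : Type) (A : set U) :
  [set: T] #<= A <-> exists f : T -> U, injective f /\ forall x, A (f x).
Proof.
rewrite -(card_le_eqr (card_setT A)) card_leTP; split=> [[f injf]|[f [injf Af]]].
  exists (fun x => set_val (f x)); split=> [x y /val_inj/injf//|x].
  exact: set_valP.
by exists (fun x => SigSub (mem_set (Af x))) => x y [/injf].
Qed.

Lemma card_le_partial (T : Type) (A B : set T) : A #<= B ->
  exists h : T -> T, (forall x, A x -> B (h x)) /\
    (forall x y, A x -> A y -> h x = h y -> x = y).
Proof.
rewrite -(card_le_eql (card_setT A)) => /card_leT_set[f [injf fB]].
exists (fun x => if pselect (A x) is left Ax then f (SigSub (mem_set Ax)) else x).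
split=> [x Ax|x y Ax Ay]; first by case: pselect.
by case: pselect => // Ax'; case: pselect => // Ay' /injf[].
Qed.

(** Cardinals are well-ordered.  Take a maximal set [S] of choice functions that
    pairwise differ at every index.  At some index [i] the values of [S]
    exhaust [A i], since otherwise a choice function made of missed values could
    be added to [S].  Then [A i] embeds in [S], and [S] in each [A j] by
    evaluation at [j]. *)
Lemma least_cardinality (I : Type) (A : I -> Type) (i0 : I) :
  exists i, forall j, [set: A i] #<= [set: A j].
Proof.
pose P (S : set (forall i, A i)) :=
  forall f g i, S f -> S g -> f i = g i -> f = g.
have [F FP Ftot|S [PS Smax]] := @Zorn_bigcup _ P.
  move=> f g i [X FX Xf] [Y FY Yg] fg.
  have [XY|YX] := Ftot _ _ FX FY.
    exact: (FP _ FY _ _ _ (XY _ Xf) Yg fg).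
  exact: (FP _ FX _ _ _ Xf (YX _ Yg) fg).
have [[i iS]|noi] := pselect (exists i, forall a : A i, exists2 f, S f & f i = a).
  exists i => j; apply/card_leTP.
  have /choice[h hS] a : exists f, S f /\ f i = a.
    by have [f] := iS a; exists f.
  exists (fun a => h a j) => a b hab.
  have [[Sa <-] [Sb <-]] := (hS a, hS b).
  by rewrite (PS _ _ _ Sa Sb hab).
exfalso.
have missed i : exists a : A i, forall f, S f -> f i <> a.
  apply: contrapT => ni; apply: noi; exists i => a.
  apply: contrapT => na; apply: ni; exists a => f Sf fa.
  by apply: na; exists f.
pose a i := projT1 (cid (missed i)).
have aS i f : S f -> f i <> a i by rewrite /a; case: cid => /= x; apply.
apply: (Smax (S `|` [set a])).
  split=> [f Sf|aSS]; first by left.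
  by have /(aS i0)/(_ erefl) : S a by apply: aSS; right.
move=> f g i [Sf|->] [Sg|->]// fg; first exact: (PS _ _ _ Sf Sg fg).
  by case: (aS i f).
by case: (aS i g).
Qed.

Lemma card_le_total (T U : Type) (A : set T) (B : set U) :
  A #<= B \/ B #<= A.
Proof.
have [b] := @least_cardinality bool
  (fun b => if b then set_type A else set_type B) true.
case: b => [/(_ false)|/(_ true)] /=.
  by rewrite (card_le_eql (card_setT A)) (card_le_eqr (card_setT B)); left.
by rewrite (card_le_eql (card_setT B)) (card_le_eqr (card_setT A)); right.
Qed.

Lemma infinite_nat_inj (T : Type) : infinite_card T ->
  exists e : nat -> T, injective e.
Proof. by move/infiniteP/card_leTP. Qed.

Lemma left_inverse_ex (T U : Type) (A : set T) (f : T -> U) (t0 : T) :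
  (forall x y, A x -> A y -> f x = f y -> x = y) ->
  exists g : U -> T, forall x, A x -> g (f x) = x.
Proof.
move=> injf.
have /choice[g gP] u : exists x, forall y, A y -> f y = u -> y = x.
  have [[x [Ax fx]]|nx] := pselect (exists x, A x /\ f x = u).
    by exists x => y Ay fy; apply: injf => //; rewrite fx.
  by exists t0 => y Ay fy; case: nx; exists y.
by exists g => x Ax; rewrite -(gP _ _ Ax erefl).
Qed.

(** Zorn's lemma on pairs [(A, F)] where [F] embeds [A * A] into [A].  If the
    complement of a maximal [A] is no larger than [A], then [T] embeds in
    [A * A], hence in [A], and the claim follows.  Otherwise the complement
    contains a copy [h @` A] of [A], and [F] extends to [A `|` h @` A]: the new
    pairs form three copies of [A * A], which fit in that copy because [F] can
    pack two elements and a tag into one. *)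
Lemma card_setX_le (T : Type) : infinite_card T -> [set: T * T] #<= [set: T].
Proof.
move=> /infinite_nat_inj[e inje].
(* Keeping the range of [e] inside [A] makes [e 0] and [e 1] available as tags. *)
pose good (p : set T * (T -> T -> T)) := [/\ forall n, p.1 (e n),
  forall x y, p.1 x -> p.1 y -> p.1 (p.2 x y) &
  forall x y x' y', p.1 x -> p.1 y -> p.1 x' -> p.1 y' ->
    p.2 x y = p.2 x' y' -> x = x' /\ y = y'].
pose leg (p q : set T * (T -> T -> T)) := p.1 `<=` q.1 /\
  forall x y, p.1 x -> p.1 y -> q.2 x y = p.2 x y.
have [r rK] : exists r : T -> nat, forall n, r (e n) = n.
  have [|r rK] := @left_inverse_ex _ _ setT e 0%N; first by move=> m n _ _ /inje.
  by exists r => n; exact: rK.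
have good0 : good (range e, fun x y => e (pickle (r x, r y))).
  split=> [n|x y _ _|_ _ _ _ [x _ <-] [y _ <-] [x' _ <-] [y' _ <-]]/=.
  - by exists n.
  - by exists (pickle (r x, r y)).
  - by rewrite !rK => /inje/(pcan_inj pickleK)[-> ->].
pose L := {p | good p}.
pose leL (p q : L) := `[< leg (sval p) (sval q) >].
have [|||[[A F] goodA] maxA] := @ZL_preorder L (exist _ _ good0) leL.
- by move=> p; apply/asboolP; split.
- move=> p q s /asboolP[pq pq2] /asboolP[qs qs2]; apply/asboolP; split.
    exact: subset_trans qs.
  by move=> x y px py; rewrite qs2 ?pq2//; exact: pq.
- (* The bound of a chain is its union; [F x y] is read off any member that
     contains both [x] and [y]. *)
  move=> C Ctot.
  have [[c0 Cc0]|C0] := pselect (C !=set0); last first.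
    exists (exist _ _ good0) => s Cs; by case: C0; exists s.
  pose A x := exists2 p, C p & (sval p).1 x.
  have directed x y : A x -> A y ->
      exists p, [/\ C p, (sval p).1 x & (sval p).1 y].
    move=> [p Cp px] [q Cq qy].
    have [/asboolP[pq _]|/asboolP[qp _]] := Ctot _ _ Cp Cq.
      by exists q; split=> //; exact: pq.
    by exists p; split=> //; exact: qp.
  have /choice[F FP] (xy : T * T) : exists z, forall p, C p -> (sval p).1 xy.1 ->
      (sval p).1 xy.2 -> z = (sval p).2 xy.1 xy.2.
    case: xy => x y /=.
    have [[p [Cp px py]]|np] :=
      pselect (exists p, [/\ C p, (sval p).1 x & (sval p).1 y]).
      exists ((sval p).2 x y) => q Cq qx qy.
      by have [/asboolP[_ ->]|/asboolP[_ ->]] := Ctot _ _ Cp Cq.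
    by exists x => p Cp px py; case: np; exists p.
  have goodA : good (A, fun x y => F (x, y)).
    split=> [n|x y Ax Ay|x y x' y' Ax Ay Ax' Ay'] /=.
    - by exists c0 => //; case: (svalP c0).
    - have [p [Cp px py]] := directed _ _ Ax Ay.
      rewrite (FP (x, y) _ Cp px py); exists p => //.
      by case: (svalP p) => _ + _; apply.
    - have [p [Cp px py]] := directed _ _ Ax Ay.
      have [q [Cq qx qy]] := directed _ _ Ax' Ay'.
      rewrite (FP (x, y) _ Cp px py) (FP (x', y') _ Cq qx qy) /=.
      have [/asboolP[pq pq2]|/asboolP[qp qp2]] := Ctot _ _ Cp Cq.
        rewrite -(pq2 _ _ px py); case: (svalP q) => _ _; apply => //; exact: pq.
      rewrite -(qp2 _ _ qx qy); case: (svalP p) => _ _; apply => //; exact: qp.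
  exists (exist _ _ goodA) => p Cp; apply/asboolP; split=> [x px|x y px py] /=.
    by exists p.
  by rewrite (FP (x, y) _ Cp px py).
have [/= Ae AF Finj] := goodA.
pose B := [set x | ~ A x].
have [le|le] := card_le_total A B; last first.
  have [h [Ah injh]] := card_le_partial le.
  pose c x := if pselect (A x) then x else h x.
  have Ac x : A (c x).
    by rewrite /c; case: pselect => // nAx; exact: Ah.
  pose d x := F (e `[< A x >]) (c x).
  have Ad x : A (d x) by exact: AF.
  have injd : injective d.
    move=> x y /Finj[]//; rewrite /c => /inje.
    case: pselect => Ax; case: pselect => Ay.
    - by [].
    - by rewrite (asboolT Ax) (asboolF Ay).
    - by rewrite (asboolF Ax) (asboolT Ay).
    - by move=> _; exact: injh.
  apply/card_leTP; exists (fun xy => F (d xy.1) (d xy.2)).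
  by move=> [x y] [x' y'] /= /Finj[]// => /injd -> /injd ->.
have [h [Bh injh]] := card_le_partial le.
pose A' := A `|` h @` A.
(* [c] undoes [h] on the copy; a point of [A'] is known from its image under
   [c] and from whether it lies in [A]. *)
have [c cP] : exists c : T -> T, forall x, A x -> c x = x /\ c (h x) = x.
  have [k kP] := left_inverse_ex (e 0) injh.
  exists (fun x => if pselect (A x) then x else k x) => x Ax; split.
    by case: pselect.
  by have nAhx := Bh _ Ax; case: pselect => // ?; exact: kP.
have Ac x : A' x -> A (c x).
  by move=> [Ax|[y Ay <-]]; [rewrite (cP x Ax).1|rewrite (cP y Ay).2].
have injc x y : A' x -> A' y -> `[< A x >] = `[< A y >] -> c x = c y -> x = y.
  move=> [Ax|[u Au <-]] [Ay|[v Av <-]].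
  - by have [[-> _] [-> _]] := (cP _ Ax, cP _ Ay).
  - by rewrite (asboolT Ax) (asboolF (Bh _ Av)).
  - by rewrite (asboolF (Bh _ Au)) (asboolT Ay).
  - by have [[_ ->] [_ ->]] := (cP _ Au, cP _ Av) => _ ->.
pose G x y := F (F (e `[< A x >]) (e `[< A y >])) (F (c x) (c y)).
have AG x y : A' x -> A' y -> A (G x y).
  by move=> /Ac cx /Ac cy; exact: AF (AF _ _ (Ae _) (Ae _)) (AF _ _ cx cy).
have injG x y x' y' : A' x -> A' y -> A' x' -> A' y' ->
    G x y = G x' y' -> x = x' /\ y = y'.
  have Ftag (a b : nat) : A (F (e a) (e b)) by exact: AF.
  have Fc u v : A' u -> A' v -> A (F (c u) (c v)) by move=> /Ac ? /Ac; exact: AF.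
  move=> A'x A'y A'x' A'y' /(Finj _ _ _ _ (Ftag _ _) (Fc _ _ A'x A'y)
    (Ftag _ _) (Fc _ _ A'x' A'y'))[].
  move=> /(Finj _ _ _ _ (Ae _) (Ae _) (Ae _) (Ae _))[/inje tx /inje ty].
  move=> /(Finj _ _ _ _ (Ac _ A'x) (Ac _ A'y) (Ac _ A'x') (Ac _ A'y'))[cx cy].
  have b2n (a b : bool) : a = b :> nat -> a = b by case: a; case: b.
  by split; apply: injc => //; exact: b2n.
pose F' x y := if pselect (A x /\ A y) then F x y else h (G x y).
have goodA' : good (A', F').
  split=> [n|x y A'x A'y|x y x' y' A'x A'y A'x' A'y']; rewrite /= ?/F'.
  - by left.
  - case: pselect => [[Ax Ay]|?] /=; first by left; exact: AF.
    by right; exists (G x y) => //; exact: AG.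
  - case: pselect => [[Ax Ay]|?] /=; case: pselect => [[Ax' Ay']|?] /=.
    + exact: Finj.
    + move=> FG; have := Bh (G x' y') (AG _ _ A'x' A'y'); rewrite -FG.
      by have := AF _ _ Ax Ay.
    + move=> FG; have := Bh (G x y) (AG _ _ A'x A'y); rewrite FG.
      by have := AF _ _ Ax' Ay'.
    + by move/injh => GG; apply: injG => //; apply: GG; exact: AG.
have ext : leL (exist _ _ goodA) (exist _ _ goodA').
  apply/asboolP; split=> [x Ax|x y Ax Ay] /=; first by left.
  by rewrite /F'; case: pselect => // -[].
have /asboolP[/= A'A _] := maxA _ ext.
case: (Bh (e 0) (Ae 0)); apply: A'A; right; exact: imageP.
Qed.

Lemma card_option_le (T : Type) :
  infinite_card T -> [set: option T] #<= [set: T].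
Proof.
move=> infT; apply: card_le_trans (card_setX_le infT).
have [e inje] := infinite_nat_inj infT.
apply/card_leTP; exists (fun o => if o is Some x then (e 0, x) else (e 1, e 0)).
by move=> [x|] [y|] // [] => [->|/inje|/esym/inje].
Qed.

Lemma card_seq_le (T : Type) : infinite_card T -> [set: seq T] #<= [set: T].
Proof.
move=> infT; have /card_leTP[f injf] := card_setX_le infT.
have [e inje] := infinite_nat_inj infT.
(* The code [e 0] of the empty sequence may also be a value of [f], so [code] is
   injective only on sequences of a given length. *)
pose code := foldr (fun x y => f (x, y)) (e 0).
apply/card_leTP; exists (fun s => f (e (size s), code s)) => s t.
move=> /injf[/inje]; elim: s t => [|x s IHs] [|y t]//= [st].
by move=> /injf[-> /(IHs _ st) ->].
Qed.

(** * Initial well-orders and cofinality *)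

Section WellOrder.
Context (K : Type) (R : rel K) (Rwo : wochoice.well_order R).

Lemma well_order_min (P : K -> Prop) :
  (exists x, P x) -> exists2 z, P z & forall x, P x -> R z x.
Proof.
move=> [x Px]; have [|z [[Pz Rz] _]] := Rwo (A := [pred y | `[< P y >]]).
  by exists x; exact/asboolP.
by exists z => [|y Py]; [exact/asboolP|apply: Rz; exact/asboolP].
Qed.

Lemma well_order_anti x y : R x y -> R y x -> x = y.
Proof.
move=> Rxy Ryx; have Rr z : R z z.
  have [|u -> Ru] := @well_order_min (fun u => u = z); first by exists z.
  exact: Ru.
have [|z [_ zP]] := Rwo (A := [pred u | `[< u = x \/ u = y >]]).
  by exists x; apply/asboolP; left.
transitivity z; first symmetry; apply: zP; split.
- by apply/asboolP; left.
- by move=> u /asboolP[]->.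
- by apply/asboolP; right.
- by move=> u /asboolP[]->.
Qed.

Lemma well_order_total x y : R x y \/ R y x.
Proof.
have [|z [->|->] Rz] := @well_order_min (fun u => u = x \/ u = y).
- by exists x; left.
- by left; apply: Rz; right.
- by right; apply: Rz; left.
Qed.

Lemma well_order_refl x : R x x.
Proof. by case: (well_order_total x x). Qed.

Lemma well_order_trans y x z : R x y -> R y z -> R x z.
Proof.
move=> Rxy Ryz.
have [|u uP Ru] := @well_order_min (fun u => [\/ u = x, u = y | u = z]).
  by exists x; apply: Or31.
case: uP Ru => -> Ru; first by apply: Ru; apply: Or33.
  by rewrite (@well_order_anti x y)//; apply: Ru; apply: Or31.
have zy : y = z by apply: well_order_anti => //; apply: Ru; apply: Or32.
by rewrite -zy.
Qed.

Lemma well_order_wf : well_founded (fun y x => ~~ R x y).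
Proof.
move=> x; apply: contrapT => nx.
have [|z nz Rz] := @well_order_min (fun u => ~ Acc (fun y x => ~~ R x y) u).
  by exists x.
apply: nz; constructor => y nRzy; apply: contrapT => /Rz.
exact/negP.
Qed.

Lemma well_order_finite_max (x0 : K) (A : set K) : finite_set A ->
  exists m, forall x, A x -> R x m.
Proof.
move=> /(@finite_seqP {classic K} A)[s ->].
elim: s => [|y s [m mP]]; first by exists x0.
have [ym|my] := well_order_total y m.
  by exists m => x /=; rewrite inE => /predU1P[->//|/mP].
exists y => x /=; rewrite inE => /predU1P[->|/mP xm].
  exact: well_order_refl.
exact: well_order_trans xm my.
Qed.

End WellOrder.

(** In any well-order, either the whole order is initial or the strict
    predecessors of a least large point carry, up to a copy of [K], an initial
    order. *)
Lemma initial_well_order_exists (K : Type) :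
  exists R : rel K, initial_well_order R.
Proof.
have [R Rwo] := wochoice.well_ordering_principle {classic K}.
have leT (S : set K) : S #<= [set: K] by exact: card_leT.
have [big|nobig] := pselect (exists x : K, [set: K] #<= [set y : K | ~~ R x y]).
  have [x /card_leT_set[f [injf fx]] xmin] := well_order_min Rwo big.
  exists (fun i j => R (f i) (f j)); split.
    apply: wochoice.antisymmetric_well_order.
      by move=> i j /andP[Rij Rji]; apply: injf; exact: well_order_anti Rij Rji.
    move=> A [i Ai].
    have [|z [j Aj <-] zmin] := well_order_min Rwo (P := f @` [set` A]).
      by exists (f i), i.
    by exists j; split=> // k Ak; apply: zmin; exists k.
  move=> i; split=> // /card_leT_set[g [injg gi]].
  have /negP := fx i; apply; apply: xmin.
  by apply/card_leT_set; exists (f \o g); split=> [|j]; [exact: inj_comp|exact: gi].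
by exists R; split=> // x; split=> // le; apply: nobig; exists x.
Qed.

Lemma cofinality_exists (K : Type) : exists C, cofinality K C.
Proof.
have [R RK] := initial_well_order_exists K.
have Rwo := RK.1.
pose I := {A : set K | cofinal R A}.
have cofT : cofinal R setT by move=> x; exists x => //; exact: well_order_refl.
have [[A cofA] minA] :=
  @least_cardinality I (fun A => set_type (sval A)) (exist _ _ cofT).
exists (set_type A); exists R => //; split.
  by exists A => //; exact: card_setT.
move=> M [B cofB MB]; have /= := minA (exist _ _ cofB).
by rewrite (card_le_eqr (card_setT B)) (card_le_eqr MB).
Qed.

(** If no initial segment covers [F], an injection of [K] into [F] is built by
    recursion: at each stage the values already used do not exhaust [F]. *)
Lemma initial_lt_segment (K : Type) (R : rel K) (F : Type) :
  initial_well_order R -> ~ ([set: K] #<= [set: F]) ->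
  exists x, [set: F] #<= [set y | ~~ R x y].
Proof.
move=> [Rwo _] nKF; apply: contrapT => small; apply: nKF.
have fresh x (h : forall y, ~~ R x y -> F) : exists a, forall y yx, h y yx <> a.
  apply: contrapT => onto; apply: small; exists x.
  have /choice[g gP] (a : F) : exists y, exists yx : ~~ R x y, h y yx = a.
    apply: contrapT => na; apply: onto; exists a => y yx hy.
    by apply: na; exists y, yx.
  apply/card_leT_set; exists g; split=> [a b|a]; last by case: (gP a).
  move=> gab; have [[ya ha] [yb hb]] := (gP a, gP b).
  rewrite -ha -hb; move: (g a) (g b) ya yb gab {ha hb} => y z ya yb yz; subst z.
  by congr h; exact: bool_irrelevance.
pose h := Fix (well_order_wf Rwo) (fun=> F) (fun x h => projT1 (cid (fresh x h))).
have hE x : h x = projT1 (cid (fresh x (fun y _ => h y))).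
  rewrite /h Fix_eq// => u f g fg; have -> // : f = g.
  by apply: functional_extensionality_dep => y; apply: funext => yx; exact: fg.
have h_neq x y : ~~ R x y -> h y <> h x.
  by move=> xy; rewrite (hE x); case: cid => a /= /(_ y xy).
apply/card_leTP; exists h => x y hxy.
case: (boolP (R x y)) => [Rxy|/h_neq[]//].
case: (boolP (R y x)) => [Ryx|/h_neq[]//].
exact: well_order_anti Rxy Ryx.
Qed.

Lemma card_setX_lt (K A B : Type) : infinite_card K ->
  ~ ([set: K] #<= [set: A]) -> ~ ([set: K] #<= [set: B]) ->
  ~ ([set: K] #<= [set: A * B]).
Proof.
move=> infK nA nB.
wlog AB : A B nA nB / [set: A] #<= [set: B].
  move=> gen; have [AB|BA] := card_le_total [set: A] [set: B]; first exact: gen.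
  move=> KAB; apply: (gen B A nB nA BA); apply: card_le_trans KAB _.
  by apply/card_leTP; exists (fun p => (p.2, p.1)) => -[? ?] [? ?] [-> ->].
move=> KAB; have {}KAB : [set: K] #<= [set: B * B].
  apply: card_le_trans KAB _; have /card_leTP[f injf] := AB.
  by apply/card_leTP; exists (fun p => (f p.1, p.2)) => -[? ?] [? ?] /= [/injf-> ->].
have [finB|infB] := pselect (finite_set [set: B]); last first.
  by apply: nB; exact: card_le_trans KAB (card_setX_le infB).
apply: infK; apply: card_le_finite KAB _.
by rewrite -setXTT; exact: finite_setX.
Qed.

Lemma card_le_fibres (K E : Type) (g : K -> E) (B : set K) :
  (forall e, [set i | g i = e] #<= B) -> [set: K] #<= [set: E * B].
Proof.
move=> gB; have /choice[f fP] e := card_le_partial (gB e).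
have fB i : B (f (g i) i) by exact: (fP (g i)).1.
apply/card_leTP; exists (fun i => (g i, SigSub (mem_set (fB i) : _ \in B))).
move=> i j [gij fij]; apply: (fP (g i)).2 => //=.
by rewrite fij gij.
Qed.

(** Were all fibres smaller than [K], each would embed in a proper initial
    segment of [K].  The ends of these segments are too few to be cofinal, so a
    single segment bounds all the fibres, and [K] would embed in a product of
    two smaller cardinals. *)
Lemma cofinality_pigeonhole (K L E : Type) (g : K -> E) : infinite_card K ->
  cofinality_gt K L -> [set: E] #<= [set: L] ->
  exists e, [set: K] #<= [set i | g i = e].
Proof.
move=> infK [C [R RK [_ Cmin]] [LC nCL]] EL.
have Rwo := RK.1; apply: contrapT => nofib.
have /choice[x xP] e : exists x, [set i | g i = e] #<= [set y | ~~ R x y].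
  have [|x] := initial_lt_segment (F := [set i | g i = e]) RK.
    by rewrite (card_le_eqr (card_setT _)) => Ke; apply: nofib; exists e.
  by rewrite (card_le_eql (card_setT _)); exists x.
have nKE : ~ ([set: K] #<= [set: E]).
  move=> KE; apply: nCL; apply: card_le_trans EL; apply: card_le_trans KE.
  by apply: Cmin; exists setT => // y; exists y => //; exact: well_order_refl.
have [bnd ubx] : exists bnd, forall e, ~~ R bnd (x e).
  apply: contrapT => nub; apply: nCL; apply: card_le_trans EL.
  apply: card_le_trans (card_image_le x [set: E]).
  rewrite -(card_le_eqr (card_setT _)); apply: Cmin.
  exists (range x); last exact: card_setT.
  move=> y; apply: contrapT => ny; apply: nub; exists y => e.
  by apply/negP => Rye; apply: ny; exists (x e).
apply: (@card_setX_lt K E [set y | ~~ R bnd y]) => //.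
  by rewrite (card_le_eqr (card_setT _)); exact: (RK.2 bnd).2.
apply: (@card_le_fibres _ _ g) => e; apply: card_le_trans (xP e) _.
apply: subset_card_le => y /= xy; apply: contra xy => Ry.
have [Rxb|Rbx] := well_order_total Rwo (x e) bnd.
  exact: well_order_trans Rxb Ry.
by have := ubx e; rewrite Rbx.
Qed.

(** * Calibers and families of open sets *)

Lemma caliber_of_dense_family (Z : topologicalType) (K L E : Type) (d : E -> Z) :
  (forall U, open U -> U !=set0 -> exists e, U (d e)) ->
  [set: E] #<= [set: L] -> infinite_card K -> cofinality_gt K L -> caliber Z K.
Proof.
move=> dd EL infK KL I IK U oU U0.
have /choice[g gU] i : exists e, U i (d e) by exact: dd.
have [h injh] : exists h : K -> I, injective h.
  by apply/card_leTP; move: IK; rewrite card_eq_le => /andP[].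
have [e eK] := cofinality_pigeonhole (g \o h) infK KL EL.
exists [set i | g i = e]; last by exists (d e) => i /= <-.
rewrite card_eq_le -(card_le_eqr IK) card_leT /=.
have /card_leT_set[f [injf fe]] := eK.
by apply/card_leT_set; exists (h \o f); split=> [|k]; [exact: inj_comp|exact: fe].
Qed.

(** If [cf K <= L], send each [k] to a bound [xi k] taken in a cofinal set of at
    most [L] points, and repeat the sets [V a] along this map.  A subfamily with
    a common point uses finitely many [V a], so its indices are bounded in [K]
    and are fewer than [K]. *)
Lemma cofinality_gt_of_caliber (Z : topologicalType) (K L : Type) (V : L -> set Z) :
  (forall a, open (V a)) -> (forall a, V a !=set0) ->
  (forall z, finite_set [set a | V a z]) ->
  infinite_card K -> caliber Z K -> cofinality_gt K L.
Proof.
move=> oV V0 Vfin infK calK; have [C KC] := cofinality_exists K.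
have [le|CL] := pselect (~ ([set: C] #<= [set: L])).
  by exists C => //; split=> //; have [] := card_le_total [set: L] [set: C].
have [R RK [[A cofA CA] _]] := KC; have Rwo := RK.1.
have /card_leTP[iota inj_iota] : [set: A] #<= [set: L].
  by rewrite (card_le_eql (card_setT A)) -(card_le_eql CA); exact: contrapT.
have /choice[xi xiP] k : exists c : A, R k (set_val c).
  have [c Ac Rkc] := cofA k.
  by exists (SigSub (mem_set Ac)).
have [J JK [z zJ]] := calK K (card_eqxx _) (fun k => V (iota (xi k)))
  (fun k => oV _) (fun k => V0 _).
have [k0 _] := infinite_setN0 infK.
(* [r] recovers the bound from its index in [L]. *)
have /choice[r rP] a : exists k, forall c, iota c = a -> set_val c = k.
  have [[c ca]|nc] := pselect (exists c, iota c = a); last first.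
    by exists k0 => c ca; case: nc; exists c.
  by exists (set_val c) => c'; rewrite -ca => /inj_iota ->.
have finJ : finite_set [set set_val (xi k) | k in J].
  apply: sub_finite_set (finite_image r (Vfin z)) => _ [k Jk <-].
  by exists (iota (xi k)); [exact: zJ|rewrite (rP _ (xi k) erefl)].
have [m mP] : exists m, forall k, J k -> R k m.
  have [m mP] := well_order_finite_max Rwo k0 finJ.
  by exists m => k Jk; apply: (well_order_trans Rwo (xiP k)); apply: mP; exists k.
pose S := [set y | ~~ R m y].
exfalso; have [_] := RK.2 m; apply.
(* [J] lies below [m], and [option S] is the set of points below [m]: [None]
   stands for [m] itself. *)
have KS : [set: K] #<= [set: option S].
  rewrite -(card_le_eql JK) -(card_le_eql (card_setT J)).
  pose f (k : K) : option S :=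
    if pselect (S k) is left Sk then Some (SigSub (mem_set Sk)) else None.
  apply/card_leTP; exists (f \o set_val) => k l /=.
  have [/mP km /mP lm] := (set_valP k, set_valP l).
  have eqm u : R u m -> ~ S u -> u = m.
    by move=> um /negP; rewrite negbK => mu; exact: well_order_anti um mu.
  rewrite /f; case: pselect => Sk; case: pselect => Sl //.
    by case=> kl; exact: val_inj.
  by move=> _; apply: val_inj; rewrite /= (eqm _ km Sk) (eqm _ lm Sl).
have infS : infinite_card S.
  move=> finS; apply: infK; apply: card_le_finite KS _.
  rewrite (_ : [set: option S] = None |` (some @` [set: S])).
    by rewrite finite_setU; split; [exact: finite_set1|exact: finite_image].
  by apply/seteqP; split=> // -[s|] _; [right; exists s|left].
rewrite -(card_le_eqr (card_setT S)).
exact: card_le_trans KS (card_option_le infS).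
Qed.

(** * Boxes in products *)

Lemma prod_coord_continuous (I : Type) (X : I -> topologicalType) (i : I) :
  continuous (fun z : prod_topology X => z i).
Proof.
move=> z; have /cvg_sup/(_ i) zi : z --> z by exact: cvg_id.
move=> A /(@initial_continuous _ _ (fun z : forall i, X i => z i) z) zA; exact: zi.
Qed.

(** The sets containing a box with finitely many constrained coordinates form a
    filter which converges to [p] in each coordinate, hence in the product, so
    [O] is one of them. *)
Lemma prod_nbhs_box (I : Type) (X : I -> topologicalType) (p : prod_topology X)
    (O : set (prod_topology X)) : nbhs p O ->
  exists (D : set I) (N : forall i, set (X i)), [/\ finite_set D,
    forall i, nbhs (p i) (N i) &
    forall z, (forall i, D i -> N i (z i)) -> O z].
Proof.
pose F : set_system (prod_topology X) := fun O =>
  exists (D : set I) (N : forall i, set (X i)), [/\ finite_set D,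
    forall i, nbhs (p i) (N i) &
    forall z, (forall i, D i -> N i (z i)) -> O z].
have FF : Filter F.
  split.
  - by exists set0, (fun=> setT); split=> // i; exact: filterT.
  - move=> P Q [D [N [finD nN NP]]] [E [M [finE nM MQ]]].
    exists (D `|` E), (fun i => N i `&` M i); split.
    + by rewrite finite_setU.
    + by move=> i; exact: filterI.
    + move=> z zDE; split; [apply: NP|apply: MQ] => i Di.
        by have [] := zDE i (or_introl Di).
      by have [] := zDE i (or_intror Di).
  - move=> P Q PQ [D [N [finD nN NP]]]; exists D, N; split=> // z /NP; exact: PQ.
have Fp : F --> p.
  apply/cvg_sup => i A [_ [[W oW <-] Wp WA]].
  (* [N] must be given at every index; the cast moves [W] to indices equal to [i]. *)
  exists [set i], (fun j x => forall e : j = i, W (ecast k (X k) e x)); split.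
  - exact: finite_set1.
  - move=> j; have [ji|nji] := pselect (j = i).
      subst j.
      apply: filterS (open_nbhs_nbhs (conj oW Wp)) => x Wx e.
      by rewrite (Prop_irrelevance e erefl).
    by apply: nearW => x e.
  - by move=> z /(_ i erefl) /(_ erefl); exact: WA.
exact: Fp.
Qed.

(** * Separating families and interpolation *)

Local Open Scope ring_scope.

Lemma tychonoff_separate (R : realType) (Y : topologicalType) (x y : Y) :
  tychonoff_space Y -> x <> y ->
  exists h : Y -> R, [/\ continuous h, h x = 1 & h y = 0].
Proof.
move=> [creg T1] xy.
have := creg y [set x] (accessible_closed_set1 T1 (x := x)) (fun yx => xy (esym yx)).
move=> /(@uniform_separatorP _ R)[h [ch _ hy hx]].
exists h; split=> //; first by apply: (hx (h x)); exists x.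
by apply: (hy (h y)); exists y.
Qed.

Lemma tychonoff_separate_nbhs (R : realType) (Y : topologicalType) (x y : Y) :
  tychonoff_space Y -> x <> y -> exists (h : Y -> R) (U V : set Y),
  [/\ continuous h, nbhs x U, nbhs y V, (forall z, U z -> h z = 1) &
      forall z, V z -> h z = 0].
Proof.
move=> tY /(tychonoff_separate R tY)[h [ch hx hy]].
(* Truncating this affine function to [0, 1] makes it constant near [x] and [y]. *)
pose ramp (z : Y) : R := 3 * h z - 1.
have cramp : continuous ramp.
  move=> z; apply: cvgB; last exact: cvg_cst.
  by apply: cvgM; [exact: cvg_cst|exact: ch].
exists (cst 1 \min (cst 0 \max ramp)).
exists (h @^-1` [set r | 2/3 < r]), (h @^-1` [set r | r < 1/3]).
have nbhs_h z (S : set R) : open S -> S (h z) -> nbhs z (h @^-1` S).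
  by move=> oS Sz; apply: ch; exact: open_nbhs_nbhs.
split.
- move=> z; apply: continuous_min; first exact: cst_continuous.
  by apply: continuous_max; [exact: cst_continuous|exact: cramp].
- by apply: nbhs_h; [exact: open_gt|rewrite hx /=; lra].
- by apply: nbhs_h; [exact: open_lt|rewrite hy /=; lra].
- move=> z /= hz; rewrite /ramp; apply/min_idPl; rewrite le_max; apply/orP; right.
  by lra.
- move=> z /= hz; rewrite /ramp (max_idPl _); last by lra.
  by apply/min_idPr; lra.
Qed.

(** Asking for the exact values 1 and 0, and not just for distinct values, lets
    finite products of the functions interpolate without division. *)
Definition separating01 (R : realType) (T : Type) (X : topologicalType)
    (phi : T -> X -> R) :=
  (forall t, continuous (phi t)) /\
  forall x y, x <> y -> exists t, phi t x = 1 /\ phi t y = 0.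

(** For each pair of sets of a base of the coarser space, keep one function that
    is 1 on the first and 0 on the second, if there is any.  Distinct points
    have basic neighbourhoods for which there is one. *)
Lemma iweight_separating01 (R : realType) (L : Type) (X : topologicalType) :
  iweight_le X L -> exists phi : L * L -> X -> R, separating01 phi.
Proof.
move=> [W [[Y [tY [c [cc cbij]] [M [[B [Bopen Bbase] MB] _] WM]] _] WL]].
have /card_leTP[code inj_code] : [set: B] #<= [set: L].
  rewrite (card_le_eql (card_setT B)) -(card_le_eql MB).
  apply: card_le_trans WL; rewrite (card_le_eqr WM).
  by apply/card_leTP; exists inl => ? ? [].
pose sep (U V : set Y) (h : Y -> R) :=
  (forall z, U z -> h z = 1) /\ forall z, V z -> h z = 0.
have /choice[phi phiP] (lm : L * L) : exists h : Y -> R, continuous h /\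
    forall (U V : B) g, code U = lm.1 -> code V = lm.2 -> continuous g ->
      sep (set_val U) (set_val V) g -> sep (set_val U) (set_val V) h.
  have [[h [U [V [UV1 UV2 ch sh]]]]|noh] :=
    pselect (exists (h : Y -> R) (U V : B), [/\ code U = lm.1, code V = lm.2,
      continuous h & sep (set_val U) (set_val V) h]).
    exists h; split=> // U' V' g U'1 V'2 _ _.
    have -> : U' = U by apply: inj_code; rewrite U'1.
    by have -> : V' = V by apply: inj_code; rewrite V'2.
  exists (fun=> 0); split; first by move=> ?; exact: cst_continuous.
  by move=> U V g U1 V2 cg sg; case: noh; exists g, U, V.
exists (fun lm => phi lm \o c); split=> [lm x|x y xy].
  by apply: continuous_comp; [exact: cc|exact: (phiP lm).1].
have cxy : c x <> c y by move=> /(bij_inj cbij).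
have [h [U [V [ch nU nV hU hV]]]] := tychonoff_separate_nbhs R tY cxy.
have [U' [BU' U'x] U'U] := Bbase _ _ nU.
have [V' [BV' V'y] V'V] := Bbase _ _ nV.
pose U0 : B := SigSub (mem_set BU'); pose V0 : B := SigSub (mem_set BV').
exists (code U0, code V0).
have [|phi1 phi0] := (phiP (code U0, code V0)).2 U0 V0 h erefl erefl ch.
  by split=> z; [move/U'U/hU|move/V'V/hV].
by split; [exact: phi1|exact: phi0].
Qed.

Lemma prod_separating01 (R : realType) (L T : Type) (X : L -> topologicalType) :
  (forall a, exists phi : T -> X a -> R, separating01 phi) ->
  exists phi : L * T -> prod_topology X -> R, separating01 phi.
Proof.
move=> sepX; pose phi a := projT1 (cid (sepX a)).
have phiP a : separating01 (phi a) by rewrite /phi; case: cid.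
exists (fun at_ (z : prod_topology X) => phi at_.1 at_.2 (z at_.1)).
split=> [[a t] z /=|z w zw].
  apply: (@continuous_comp _ _ _ (fun z : prod_topology X => z a) (phi a t)).
    exact: prod_coord_continuous.
  exact: (phiP a).1.
have [a za] : exists a, z a <> w a.
  apply: contrapT => no; apply: zw; apply: functional_extensionality_dep => a.
  by apply: contrapT => za; apply: no; exists a.
by have [t tP] := (phiP a).2 _ _ za; exists (a, t).
Qed.

Definition rat_combination (R : realType) (T : Type) (X : topologicalType)
    (phi : T -> X -> R) (c : seq (rat * seq T)) (x : X) : R :=
  \sum_(m <- c) ratr m.1 * \prod_(t <- m.2) phi t x.

Lemma rat_combination_continuous (R : realType) (T : Type) (X : topologicalType)
    (phi : T -> X -> R) c :
  (forall t, continuous (phi t)) -> continuous (rat_combination phi c).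
Proof.
move=> cphi; have cprod ts : continuous (fun x => \prod_(t <- ts) phi t x).
  elim: ts => [|t ts IH] x.
    under eq_fun do rewrite big_nil; exact: cst_continuous.
  under eq_fun do rewrite big_cons.
  by apply: cvgM; [exact: cphi|exact: IH].
rewrite /rat_combination; elim: c => [|m c IH] x.
  under eq_fun do rewrite big_nil; exact: cst_continuous.
under eq_fun do rewrite big_cons.
apply: cvgD; last exact: IH.
by apply: cvgM; [exact: cvg_cst|exact: cprod].
Qed.

(** Lagrange interpolation: each [x] in [D] contributes a rational
    approximation of [f x] times the product, over the other points [y] of [D],
    of some [phi t] that is 1 at [x] and 0 at [y].  The other terms vanish at
    [x], so the approximation of [f x] is the only source of error there. *)
Lemma rat_combination_dense (R : realType) (T : Type) (X : topologicalType)
    (phi : T -> X -> R) (f : X -> R) (D : set X) (N : X -> set R) :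
  T -> separating01 phi -> finite_set D -> (forall x, nbhs (f x) (N x)) ->
  exists c, forall x, D x -> N x (rat_combination phi c x).
Proof.
move=> t0 [_ sep] /finite_seqP[s0 ->] nN.
pose s := undup s0.
have /choice[q qN] x : exists q : rat, N x (ratr q).
  have [r [Nr [q _ qr]]] : (N x)^° `&` range (@ratr R) !=set0.
    apply: dense_rat; last exact: open_interior.
    by exists (f x); exact: nN.
  by exists q; rewrite qr; exact: interior_subset.
have /choice[t tP] (xy : X * X) :
    exists t, xy.1 <> xy.2 -> phi t xy.1 = 1 /\ phi t xy.2 = 0.
  have [eq_xy|/sep[t tP]] := pselect (xy.1 = xy.2); last by exists t.
  (* [t0] only fills the diagonal. *)
  by exists t0.
exists [seq (q x, [seq t (x, y) | y <- s & y != x]) | x <- s] => x.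
rewrite /= -mem_undup -/s => sx.
rewrite /rat_combination big_map (bigD1_seq x) ?undup_uniq//= [X in _ + X]big1_seq.
  rewrite addr0 big_map big_filter big1_seq ?mulr1; first exact: qN.
  by move=> y /andP[yx _]; apply: (tP (x, y) _).1 => /= xy; rewrite xy eqxx in yx.
move=> y /andP[yx sy]; rewrite big_map (bigD1_seq x) ?filter_uniq ?undup_uniq//=.
  by rewrite (tP (y, x) _).2 ?mul0r ?mulr0//= => xy; rewrite xy eqxx in yx.
by rewrite mem_filter eq_sym yx.
Qed.

(** * Spaces of continuous functions *)

Section Cp.
Context (R : realType) (X : topologicalType).

Definition Cp_eval (f : Cp R X) (x : X) : R := (set_val f : {ptws X -> R}) x.

Lemma Cp_eval_continuous (f : Cp R X) : continuous (Cp_eval f).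
Proof. exact: (set_valP f). Qed.

Lemma continuous_Cp (f : X -> R) :
  continuous f -> exists F : Cp R X, Cp_eval F = f.
Proof.
move=> cf; pose C := [set f : {ptws X -> R} | continuous (f : X -> R)].
by exists (SigSub (mem_set (cf : C f))).
Qed.

Lemma Cp_open_preimage (x : X) (W : set R) :
  open W -> open [set f : Cp R X | W (Cp_eval f x)].
Proof.
move=> oW; have cx : continuous (fun g : {ptws X -> R} => g x).
  exact: (@prod_coord_continuous X (fun=> R) x).
exists [set g : {ptws X -> R} | W (g x)] => //.
by have /continuousP := cx; exact.
Qed.

Lemma Cp_open_box (U : set (Cp R X)) (f : Cp R X) : open U -> U f ->
  exists (D : set X) (N : X -> set R), [/\ finite_set D,
    forall x, nbhs (Cp_eval f x) (N x) &
    forall g, (forall x, D x -> N x (Cp_eval g x)) -> U g].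
Proof.
move=> [W oW <-] Wf.
have [D [N [finD nN NW]]] := prod_nbhs_box (open_nbhs_nbhs (conj oW Wf)).
by exists D, N; split=> // g; exact: NW.
Qed.

Lemma Cp_dense_family (T : Type) (phi : T -> X -> R) : T -> separating01 phi ->
  exists d : seq (rat * seq T) -> Cp R X,
    forall U, open U -> U !=set0 -> exists e, U (d e).
Proof.
move=> t0 phiP.
have /choice[d dE] c : exists F : Cp R X, Cp_eval F = rat_combination phi c.
  by apply: continuous_Cp; exact: rat_combination_continuous phiP.1.
exists d => U oU [f Uf].
have [D [N [finD nN NU]]] := Cp_open_box oU Uf.
have [c cN] := rat_combination_dense t0 phiP finD nN.
by exists c; apply: NU => x Dx; rewrite dE; exact: cN.
Qed.

End Cp.

Lemma card_codes_le (L : Type) : infinite_card L ->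
  [set: seq (rat * seq (L * (L * L)))] #<= [set: L].
Proof.
move=> infL.
have mulL (A B : Type) : [set: A] #<= [set: L] -> [set: B] #<= [set: L] ->
    [set: A * B] #<= [set: L].
  move=> /card_leTP[f injf] /card_leTP[g injg].
  apply: card_le_trans (card_setX_le infL).
  apply/card_leTP; exists (fun p => (f p.1, g p.2)).
  by move=> [? ?] [? ?] /= [/injf-> /injg->].
have seqL (A : Type) : [set: A] #<= [set: L] -> [set: seq A] #<= [set: L].
  move=> /card_leTP[f injf]; apply: card_le_trans (card_seq_le infL).
  by apply/card_leTP; exists (map f); exact: inj_map.
apply/seqL/mulL.
  apply: (@card_le_trans _ _ _ [set: nat]); last exact/infiniteP.
  exact: countableP.
by apply/seqL/mulL => //; exact/mulL.
Qed.

(** A caliber [K] must satisfy [cf K > L]: pick [p a <> q a] in each factor and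
    let [e a] be [p] with its [a]-th coordinate changed to [q a].  Every
    neighbourhood of [p] contains all but finitely many [e a], so a continuous
    [f] with [f p < 0] is positive at finitely many [e a] only.  Hence the open
    sets [V a] of all [f] with [f p < 0 < f (e a)] are point-finite; they are
    nonempty because [X a] is Tychonoff. *)
Lemma calibers_Cp_prod (R : realType) (L : Type) (X : L -> topologicalType)
    (K : Type) :
  infinite_card L -> (forall a, nontrivial_space (X a)) ->
  (forall a, tychonoff_space (X a)) -> (forall a, iweight_le (X a) L) ->
  calibers (Cp R (prod_topology X)) K <-> infinite_card K /\ cofinality_gt K L.
Proof.
move=> infL X2 tX wX; split=> [[infK calK]|[infK KL]]; last first.
  have [phi phiP] := prod_separating01 (fun a => iweight_separating01 R (wX a)).
  have [l0 _] := infinite_setN0 infL.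
  have [d dd] := Cp_dense_family (l0, (l0, l0)) phiP.
  split=> //; exact: caliber_of_dense_family dd (card_codes_le infL) infK KL.
split=> //.
have ptP a : exists pq : X a * X a, pq.1 <> pq.2.
  by have [x [y xy]] := X2 a; exists (x, y).
pose p : prod_topology X := fun a => (projT1 (cid (ptP a))).1.
pose q a := (projT1 (cid (ptP a))).2.
have qp a : q a <> p a by rewrite /p /q; case: cid => /= ? /nesym.
pose e a : prod_topology X := fun b => if pselect (b = a) then q b else p b.
have ea a : e a a = q a by rewrite /e; case: pselect.
have eb a b : b <> a -> e a b = p b by rewrite /e; case: pselect.
pose V a := [set f : Cp R (prod_topology X) | 0 < Cp_eval f (e a)] `&`
            [set f : Cp R (prod_topology X) | Cp_eval f p < 0].
apply: (@cofinality_gt_of_caliber _ K L V) => // [a|a|f].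
- apply: openI.
    exact: (Cp_open_preimage (e a) (@open_gt R 0)).
  exact: (Cp_open_preimage p (@open_lt R 0)).
- have [h [ch hq hp]] := tychonoff_separate R (tX a) (qp a).
  have ch' : continuous (fun x => h x - 1/2).
    by move=> x; apply: cvgB; [exact: ch|exact: cvg_cst].
  have ca : continuous (fun z : prod_topology X => h (z a) - 1/2).
    move=> z; apply: (@continuous_comp _ _ _ (fun z : prod_topology X => z a)
      (fun x => h x - 1/2)); [exact: prod_coord_continuous|exact: ch'].
  have [f fE] := continuous_Cp ca.
  by exists f; split; rewrite /= fE ?ea ?hp ?hq; lra.
- have [fp|fp] := ltP (Cp_eval f p) 0; last first.
    rewrite (_ : mkset _ = set0); first exact: finite_set0.
    by apply/seteqP; split=> // a [_] /=; rewrite ltNge fp.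
  have : nbhs p (Cp_eval f @^-1` [set r | r < 0]).
    refine (@Cp_eval_continuous R (prod_topology X) f p _ _).
    by apply: open_nbhs_nbhs; split; [exact: open_lt|].
  move=> /prod_nbhs_box[D [N [finD nN Nf]]].
  apply: sub_finite_set finD => a [/= fe _]; apply: contrapT => nDa.
  have /= : (Cp_eval f @^-1` [set r | r < 0]) (e a).
    apply: Nf => b Db; rewrite eb; first exact: nbhs_singleton (nN b).
    by move=> ba; apply: nDa; rewrite -ba.
  by rewrite ltNge (ltW fe).
Qed.

Theorem proposition7p6 (R : realType) (L : Type) (hL : infinite_card L) :
  (forall X : L -> topologicalType,
     (forall a : L, nontrivial_space (X a)) ->
     (forall a : L, tychonoff_space (X a)) ->
     (forall a : L, iweight_le (X a) L) ->
     forall K : Type,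
       calibers (Cp R (prod_topology X)) K <->
       infinite_card K /\ cofinality_gt K L)
  /\
  (forall X : topologicalType,
     nontrivial_space X ->
     tychonoff_space X ->
     iweight_le X L ->
     forall K : Type,
       calibers (Cp R {ptws L -> X}) K <->
       infinite_card K /\ cofinality_gt K L).
Proof.
by split=> [X X2 tX wX K|X X2 tX wX K]; exact: calibers_Cp_prod.
Qed.
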